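(* Let $k>2d_{\text{sp}}$. Consider $k$ environments where, in environment $e_i$, $y=1$ with probability $\eta$ and $y=-1$ otherwise; conditionally on $Y=y$, ${\mathbf x}_{\text{ns}}\sim\mathcal{N}(y\mu_{\text{ns}},\Sigma_{\text{ns}})$ and ${\mathbf x}_{\text{sp}}\sim\mathcal{N}(y\mu_i,\Sigma_i)$, drawn independently, with $\mu_{\text{ns}}\in\mathbb{R}^{d_{\text{ns}}}$, $\Sigma_{\text{ns}}\in\mathbb{S}^{d_{\text{ns}}}_{++}$, $\mu_i\in\mathbb{R}^{d_{\text{sp}}}$, $\Sigma_i\in\mathbb{S}^{d_{\text{sp}}}_{++}$. Let $\sigma:\mathbb{R}\to(0,1)$ be invertible and consider classifiers $f({\mathbf x};{\mathbf w},b)=\sigma({\mathbf w}^\top{\mathbf x}-b)$ with ${\mathbf w}=[{\mathbf w}_{\text{ns}},{\mathbf w}_{\text{sp}}]$. If the environments $\{\Sigma_i,\mu_i\}_{i=1}^k$ lie in general position, then every such classifier that is calibrated on all $k$ environments satisfies ${\mathbf w}_{\text{sp}}=\mathbf{0}$.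
   Context: $\mathbb{S}^d_{++}$ denotes the $d\times d$ symmetric positive definite matrices. A classifier $f$ is calibrated on environments $e_1,\dots,e_k$ if for each $i$ and every $\alpha$ in the range of $f$ restricted to $e_i$, $P[Y=1\mid f(X)=\alpha,E=e_i]=\alpha$. Given $k>2d_{\text{sp}}$ environments with parameters $\{\Sigma_i,\mu_i\}_{i=1}^k$, they are in general position if for every nonzero ${\mathbf x}\in\mathbb{R}^{d_{\text{sp}}}$, the vectors $\begin{bmatrix}\Sigma_i{\mathbf x}+\mu_i\\ 1\end{bmatrix}\in\mathbb{R}^{d_{\text{sp}}+1}$, $i\in[k]$, span a subspace of dimension $d_{\text{sp}}+1$. *)

(* Defs.v *)
From HB Require Import structures.
From mathcomp Require Import all_boot all_order all_algebra.
From mathcomp Require Import all_classical all_reals all_analysis.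
From mathcomp Require Import normal_distribution.
Set Implicit Arguments. Unset Strict Implicit. Unset Printing Implicit Defensive.
Import Order.TTheory GRing.Theory Num.Theory.
Local Open Scope classical_set_scope.
Local Open Scope ring_scope.

Section defs.
Context {R : realType} {dT : measure_display} {T : measurableType dT}.

Definition posdef n (S : 'M[R]_n) : Prop :=
  S^T = S /\ forall v : 'rV[R]_n, v != 0 -> 0 < (v *m S *m v^T) 0 0.

Definition dotrv n (u v : 'rV[R]_n) : R := (u *m v^T) 0 0.
Definition qform n (S : 'M[R]_n) (w : 'rV[R]_n) : R := (w *m S *m w^T) 0 0.

Definition lincomb n (w : 'rV[R]_n) (X : 'I_n -> T -> R) : T -> R :=
  fun t => \sum_(j < n) w 0 j * X j t.

(* conditionally on the event E, X ~ N(m, S): every nonzero linear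
   combination w^T X is N(w^T m, w^T S w) (normal_prob takes the std dev) *)
Definition cond_gaussian (P : probability T R) (E : set T) n
  (X : 'I_n -> T -> R) (m : 'rV[R]_n) (S : 'M[R]_n) : Prop :=
  forall w : 'rV[R]_n, w != 0 -> forall A : set R, measurable A ->
    P (E `&` lincomb w X @^-1` A) =
    (P E * normal_prob (dotrv w m) (Num.sqrt (qform S w)) A)%E.

(* conditionally on E, the random vectors X1 and X2 are independent
   (product rule on measurable rectangles, stated without division) *)
Definition cond_indep (P : probability T R) (E : set T) n1 n2
  (X1 : 'I_n1 -> T -> R) (X2 : 'I_n2 -> T -> R) : Prop :=
  forall (A : 'I_n1 -> set R) (B : 'I_n2 -> set R),
    (forall j, measurable (A j)) -> (forall j, measurable (B j)) ->
    (P (E `&` \bigcap_j (X1 j @^-1` A j) `&` \bigcap_j (X2 j @^-1` B j)) * P E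
     = P (E `&` \bigcap_j (X1 j @^-1` A j)) * P (E `&` \bigcap_j (X2 j @^-1` B j)))%E.

(* One environment: Y is the event {y = 1} (its complement is {y = -1}),
   P(y=1) = eta, given y: x_ns ~ N(y mu_ns, S_ns), x_sp ~ N(y mu_sp, S_sp),
   independently. *)
Definition env_model (P : probability T R) (Y : set T) dns dsp
  (Xns : 'I_dns -> T -> R) (Xsp : 'I_dsp -> T -> R) (eta : R)
  (mu_ns : 'rV[R]_dns) (S_ns : 'M[R]_dns) (mu_sp : 'rV[R]_dsp) (S_sp : 'M[R]_dsp)
  : Prop :=
  measurable Y /\ (forall j, measurable_fun setT (Xns j)) /\
  (forall j, measurable_fun setT (Xsp j)) /\ P Y = eta%:E /\
  cond_gaussian P Y Xns mu_ns S_ns /\ cond_gaussian P (~` Y) Xns (- mu_ns) S_ns /\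
  cond_gaussian P Y Xsp mu_sp S_sp /\ cond_gaussian P (~` Y) Xsp (- mu_sp) S_sp /\
  cond_indep P Y Xns Xsp /\ cond_indep P (~` Y) Xns Xsp.

Definition score (sigma : R -> R) dns dsp (wns : 'rV[R]_dns) (wsp : 'rV[R]_dsp)
  (b : R) (Xns : 'I_dns -> T -> R) (Xsp : 'I_dsp -> T -> R) : T -> R :=
  fun t => sigma (lincomb wns Xns t + lincomb wsp Xsp t - b).

(* calibration: P[Y = 1 | f(X)] = f(X) (a.s.), i.e. for every Borel A,
   P(Y = 1, f(X) in A) = E[f(X) 1_{f(X) in A}] *)
Definition calibrated (P : probability T R) (Y : set T) (f : T -> R) : Prop :=
  forall A : set R, measurable A ->
    P (Y `&` f @^-1` A) = (\int[P]_(t in f @^-1` A) (f t)%:E)%E.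

End defs.

Definition general_position {R : realType} k dsp
  (Sig : 'I_k -> 'M[R]_dsp) (mu : 'I_k -> 'rV[R]_dsp) : Prop :=
  forall x : 'rV[R]_dsp, x != 0 ->
    \rank (\matrix_(i < k) row_mx (x *m (Sig i)^T + mu i) (1 : 'M[R]_1)) = (dsp + 1)%N.

(* Main.v *)
(* Put h(t) = sigma(t - b). In environment i the score w^T x has law N(m_i,
   q_i) (mean, variance) given y = 1 and N(-m_i, q_i) given y = -1, so the
   posterior of y = 1 has log-odds log(eta / (1 - eta)) + 2 t m_i / q_i, and
   calibration identifies it with h(t), at least on the sets of the form
   h^-1(A) with A Borel. By Lusin's theorem h is continuous on a compact K
   of positive measure; there, h being injective, every Borel set has this
   form, and so h is the posterior a.e. on K. Hence c = m_i / q_i does not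
   depend on i, and c <> 0 since h is injective. As m_i = c q_i says that
   w_sp . (Sigma_i x + mu_i) is independent of i for x = - c w_sp, general
   position at x forces w_sp = 0. *)
Require Import Defs.
From HB Require Import structures.
From mathcomp Require Import all_boot all_order all_algebra.
From mathcomp Require Import ring lra.
From mathcomp Require Import all_classical all_reals all_analysis.
From mathcomp Require Import measurable_realfun normal_distribution.
Import Order.TTheory GRing.Theory Num.Theory.
Local Open Scope classical_set_scope.
Local Open Scope ring_scope.

(** * Normal distributions *)

Section gaussian.
Context {R : realType}.
Notation mu := (@lebesgue_measure R).
Notation mR := (measurableTypeR R).
Implicit Types (m s c : R) (A : set R).

(** The Radon-Nikodym derivative of [normal_prob] has the same integrals as [normal_pdf] over
    measurable sets, so the two agree a.e. and may be exchanged in the change of variables. *)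
Lemma ge0_integral_normal_prob m s (f : mR -> \bar R) (A : set mR) :
  measurable A -> (forall x, 0 <= f x)%E -> measurable_fun A f ->
  (\int[normal_prob m s]_(x in A) f x =
   \int[mu]_(x in A) (f x * (normal_pdf m s x)%:E))%E.
Proof.
move=> mA f0 mf.
have dom := normal_prob_dominates m s.
rewrite -(Radon_Nikodym_SigmaFinite.change_of_variables dom)//.
have mpdf (B : set mR) : measurable_fun B (fun x : mR => (normal_pdf m s x)%:E).
  by apply: measurable_funTS; apply/measurable_EFinP; exact: measurable_normal_pdf.
have mrn (B : set mR) : measurable_fun B (Radon_Nikodym_SigmaFinite.f (normal_prob m s) mu).
  by apply: measurable_funTS; apply: measurable_int (Radon_Nikodym_SigmaFinite.f_integrable dom).
apply: ae_eq_integral => //; [exact: emeasurable_funM|exact: emeasurable_funM|].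
apply: (@filterS _ _ (ae_filter_ringOfSetsType mu) (fun x => A x ->
    Radon_Nikodym_SigmaFinite.f (normal_prob m s) mu x = (normal_pdf m s x)%:E) _).
  by move=> x /= + Ax => ->.
apply: integral_ae_eq => //.
- by apply: (integrableS measurableT) => //; exact: Radon_Nikodym_SigmaFinite.f_integrable.
- by move=> B BA mB; rewrite -Radon_Nikodym_SigmaFinite.f_integral.
Qed.

(** The pushforward by a translation gives each half-open interval its length, which characterizes
    Lebesgue measure. *)
Lemma lebesgue_measure_addr c A : measurable A ->
  mu ((fun x => x + c) @^-1` A) = mu A.
Proof.
have mc : measurable_fun setT (fun x : R => x + c).
  by apply: measurable_funD => //.
move=> mA; rewrite -[LHS]/(pushforward mu (fun x => x + c) A).
have shift_itv X : ocitv X ->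
    mu X = pushforward mu (fun x : mR => x + c : mR) X.
  case=> [[a b] _ <-] /=; rewrite /pushforward.
  have -> : (fun x : R => x + c) @^-1` `]a, b] = `]a - c, b - c]%classic.
    by apply/seteqP; split => x /=; rewrite !in_itv/= ltrBlDr lerBrDr.
  rewrite !lebesgue_measure_itv/= !lte_fin ltrD2r; case: ifP => // _.
  by rewrite -!EFinB; congr EFin; ring.
by rewrite (lebesgue_measure_unique shift_itv).
Qed.

Lemma normal_prob_addr m s c (A : set mR) : s != 0 -> measurable A ->
  normal_prob m s ((fun x : R => x + c) @^-1` A) = normal_prob (m + c) s A.
Proof.
move=> s0 mA.
have pdf_shift (x : R) : normal_pdf (m + c) s (x + c) = normal_pdf m s x.
  by rewrite !normal_pdfE// /normal_fun opprD addrACA subrr addr0.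
pose shc : mR -> mR := fun x => x + c.
have mc : measurable_fun setT shc by apply: measurable_funD => //.
have mpdf : measurable_fun A (fun x : mR => (normal_pdf (m + c) s x)%:E).
  by apply: measurable_funTS; apply/measurable_EFinP; exact: measurable_normal_pdf.
rewrite /normal_prob.
transitivity (\int[pushforward mu shc]_(x in A)
    (EFin \o normal_pdf (m + c) s : mR -> \bar R) x)%E.
  rewrite ge0_integral_pushforward//; last first.
    by move=> x _; rewrite lee_fin normal_pdf_ge0.
  by apply: eq_integral => x _; rewrite /= pdf_shift.
by apply: eq_measure_integral => B mB _; exact: lebesgue_measure_addr.
Qed.

(* Completing the square in [x]: the last factor is the law of the first of two
   independent normal variables given that their sum is [z]. *)
Lemma normal_pdfM m1 s1 m2 s2 (x z : R) : s1 != 0 -> s2 != 0 ->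
  let v := s1 ^+ 2 + s2 ^+ 2 in
  normal_pdf m1 s1 x * normal_pdf (x + m2) s2 z =
  normal_pdf (m1 + m2) (Num.sqrt v) z *
  normal_pdf ((m1 * s2 ^+ 2 + (z - m2) * s1 ^+ 2) / v) (s1 * s2 / Num.sqrt v) x.
Proof.
move=> s10 s20 v.
have s1p : 0 < s1 ^+ 2 by rewrite exprn_even_gt0.
have s2p : 0 < s2 ^+ 2 by rewrite exprn_even_gt0.
have vp : 0 < v by rewrite addr_gt0.
have v0 : Num.sqrt v != 0 by rewrite gt_eqF// sqrtr_gt0.
have sv : Num.sqrt v ^+ 2 = v by rewrite sqr_sqrtr// ltW.
have pp : 0 < pi *+ 2 :> R by rewrite mulrn_wgt0// pi_gt0.
rewrite !normal_pdfE//; last by rewrite !mulf_neq0// invr_eq0.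
have peakE (t : R) : normal_peak t = (Num.sqrt (t ^+ 2 * (pi *+ 2)))^-1.
  by rewrite /normal_peak -mulrnAr.
rewrite !peakE /normal_fun !expr_div_n sv exprMn.
move: (pi *+ 2) pp => q q0.
rewrite [LHS]mulrACA [RHS]mulrACA -!expRD -!invfM -!sqrtrM; last 2 first.
- by rewrite mulr_ge0// ltW.
- by rewrite mulr_ge0// ltW.
congr (_^-1 * expR _).
  by congr Num.sqrt; field; rewrite gt_eqF.
have := gt_eqF vp; rewrite /v => /negbT v1.
by field; rewrite s10 s20 v1.
Qed.

(** The density depends only on the difference of point and mean; this gives the joint measurability
    required by Tonelli. *)
Lemma measurable_normal_pdf_mean m s : s != 0 ->
  measurable_fun setT (fun p : mR * mR => normal_pdf (p.1 + m) s p.2).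
Proof.
move=> s0.
have -> : (fun p : mR * mR => normal_pdf (p.1 + m) s p.2) =
    normal_pdf 0 s \o (fun p : mR * mR => (p.2 : R) - ((p.1 : R) + m)).
  by apply/funext => p /=; rewrite !normal_pdfE// /normal_fun subr0.
apply: measurableT_comp; first exact: measurable_normal_pdf.
apply: measurable_funB => //.
exact: measurable_funD.
Qed.

(** By Tonelli, the density of the sum at [z] is the integral over [x] of the product in
    [normal_pdfM], whose only factor depending on [x] is a density of total mass 1. *)
Lemma normal_prob_conv m1 s1 m2 s2 (A : set mR) : s1 != 0 -> s2 != 0 ->
  measurable A ->
  ((normal_prob m1 s1 \x normal_prob m2 s2)%E [set p | A (p.1 + p.2)%R] =
  normal_prob (m1 + m2) (Num.sqrt (s1 ^+ 2 + s2 ^+ 2)) A)%E.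
Proof.
move=> s10 s20 mA.
set v := s1 ^+ 2 + s2 ^+ 2.
pose g (p : mR * mR) : \bar R :=
  (normal_pdf (p.1 + m2) s2 p.2 * normal_pdf m1 s1 p.1 * \1_A p.2)%:E.
have mg : measurable_fun setT g.
  apply/measurable_EFinP; apply: measurable_funM; last first.
    by apply: measurableT_comp => //; exact: measurable_indic.
  apply: measurable_funM; first exact: measurable_normal_pdf_mean.
  by apply: measurableT_comp => //; exact: measurable_normal_pdf.
have g0 p : (0 <= g p)%E.
  by rewrite lee_fin !mulr_ge0// normal_pdf_ge0.
pose N (x : mR) : \bar R := normal_prob (x + m2)%R s2 A.
have inner (x : mR) : (N x * (normal_pdf m1 s1 x)%:E =
    \int[mu]_z g (x, z))%E.
  rewrite /N /normal_prob muleC -ge0_integralZl//; last 3 first.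
  - by apply: measurable_funTS; apply/measurable_EFinP; exact: measurable_normal_pdf.
  - by move=> z _; rewrite lee_fin normal_pdf_ge0.
  - by rewrite lee_fin normal_pdf_ge0.
  rewrite [LHS]integral_mkcond; apply: eq_integral => z _.
  by rewrite epatch_indic /g /= -!EFinM [X in (X * _)%:E]mulrC.
transitivity (\int[normal_prob m1 s1]_x N x)%E.
  (* The section at [x] is a translate of [A]; the translation moves into the mean. *)
  rewrite /product_measure1; apply: eq_integral => x _ /=; rewrite /N.
  rewrite addrC -normal_prob_addr//; congr normal_prob.
  by apply/seteqP; split => y; rewrite /xsection /= inE /= addrC.
have mN : measurable_fun setT N.
  have -> : N =
      fubini_F mu (fun p : mR * mR => (normal_pdf (p.1 + m2) s2 p.2 * \1_A p.2)%:E).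
    apply/funext => x; rewrite /N /normal_prob /fubini_F [LHS]integral_mkcond.
    by apply: eq_integral => z _; rewrite epatch_indic.
  apply: measurable_fun_fubini_tonelli_F => //.
    apply/measurable_EFinP; apply: measurable_funM; last first.
      by apply: measurableT_comp => //; exact: measurable_indic.
    exact: measurable_normal_pdf_mean.
  by move=> p; rewrite lee_fin mulr_ge0// normal_pdf_ge0.
rewrite ge0_integral_normal_prob//.
under eq_integral do rewrite inner.
rewrite (fubini_tonelli g)// /normal_prob [RHS]integral_mkcond.
apply: eq_integral => z _; rewrite epatch_indic /g/=.
under eq_integral => x _.
  rewrite [X in X * _]mulrC normal_pdfM// -/v mulrAC EFinM; over.
rewrite ge0_integralZl//; last 3 first.
- by apply/measurable_EFinP; exact: measurable_normal_pdf.
- by move=> x _; rewrite lee_fin normal_pdf_ge0.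
- by rewrite lee_fin mulr_ge0// normal_pdf_ge0.
by rewrite integral_normal_pdf mule1 EFinM.
Qed.

End gaussian.

(** * Independence and sums *)

Section independence.
Set Implicit Arguments.
Unset Strict Implicit.
Context {d : measure_display} {T : measurableType d} {R : realType}.
Variable P : probability T R.
Notation mR := (measurableTypeR R).
Implicit Types (E A B C : set T) (G : set (set T)).

(** For fixed [E] and [C] both sides are finite measures in [A]; agreement on a pi-system extends to
    the sigma-algebra it generates. *)
Lemma g_sigma_algebra_indep G E C : G `<=` measurable -> setI_closed G ->
  G setT -> measurable E -> measurable C ->
  (forall A, G A -> P (E `&` A `&` C) * P E = P (E `&` A) * P (E `&` C))%E ->
  forall A, <<s G >> A ->
    (P (E `&` A `&` C) * P E = P (E `&` A) * P (E `&` C))%E.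
Proof.
move=> Gm GI GT mE mC GP A sA.
have mEC : measurable (E `&` C) by exact: measurableI.
pose m1 := mscale (NngNum (fine_ge0 (measure_ge0 P E))) (mrestr P mEC).
pose m2 := mscale (NngNum (fine_ge0 (measure_ge0 P (E `&` C)))) (mrestr P mE).
have m1E B : m1 B = (P (E `&` B `&` C) * P E)%E.
  rewrite /m1 /mscale /= fineK ?fin_num_measure// /mrestr muleC.
  by congr (P _ * _)%E; apply/seteqP; split=> x /=; tauto.
have m2E B : m2 B = (P (E `&` B) * P (E `&` C))%E.
  by rewrite /m2 /mscale /= fineK ?fin_num_measure// /mrestr muleC (setIC B).
rewrite -m1E -m2E.
apply: (g_sigma_algebra_measure_unique G Gm (fun=> setT)) => //.
- by rewrite bigcup_const.
- by move=> B GB; rewrite [LHS]m1E [RHS]m2E GP.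
- move=> _; rewrite [ltLHS]m1E -ge0_fin_numE ?mule_ge0//.
  by rewrite fin_numM// fin_num_measure//; do !apply: measurableI.
Qed.

(** The sets in the product rule of [cond_indep]: a pi-system generating the sigma-algebra of the
    vector [X]. *)
Definition cylinders n (X : 'I_n -> T -> R) : set (set T) :=
  [set \bigcap_j (X j @^-1` A j) | A in
    [set A : 'I_n -> set R | forall j, measurable (A j)]].

Lemma cylinders_setI n (X : 'I_n -> T -> R) : setI_closed (cylinders X).
Proof.
move=> _ _ [A mA <-] [B mB <-]; exists (fun j => A j `&` B j).
  by move=> j; exact: measurableI.
apply/seteqP; split=> [t AB|t [At Bt] j _]; last by split; [exact: At|exact: Bt].
by split=> j _; have [] := AB j I.
Qed.

Lemma cylinders_setT n (X : 'I_n -> T -> R) : cylinders X setT.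
Proof.
by exists (fun=> setT) => //; apply/seteqP; split.
Qed.

Lemma cylinders_measurable n (X : 'I_n -> T -> R) :
  (forall j, measurable_fun setT (X j)) -> cylinders X `<=` measurable.
Proof.
move=> mX _ [A mA <-]; apply: fin_bigcap_measurable => // j _.
by rewrite -[X in measurable X]setTI; exact: mX.
Qed.

Lemma lincomb_cylinders n (w : 'rV[R]_n) (X : 'I_n -> T -> R) (A : set R) :
  measurable A -> <<s cylinders X >> (lincomb w X @^-1` A).
Proof.
move=> mA.
suff mw : measurable_fun setT
    (fun t : g_sigma_algebraType (cylinders X) => lincomb w X t).
  by rewrite -[_ @^-1` _]setTI; exact: mw.
apply: measurable_sum => j; apply: measurable_funM => //.
move=> _ B mB; rewrite setTI; apply: sub_sigma_algebra.
(* The cylinder constrains coordinate [j] alone. *)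
exists (fun i => if i == j then B else setT) => [i|]; first by case: ifP.
apply/seteqP; split=> t /=; first by move=> /(_ j I); rewrite eqxx.
by move=> Bt i _ /=; case: eqP => [->|].
Qed.

Lemma measurable_lincomb n (w : 'rV[R]_n) (X : 'I_n -> T -> R) :
  (forall j, measurable_fun setT (X j)) -> measurable_fun setT (lincomb w X).
Proof.
by move=> mX; apply: measurable_sum => j; exact: measurable_funM.
Qed.

(** The pi-system argument is run twice: first cylinders of [X2] are replaced by an event of [w2]
    with a cylinder of [X1] held fixed, then cylinders of [X1] by an event of [w1]. *)
Lemma lincomb_cond_indep E n1 n2 (X1 : 'I_n1 -> T -> R) (X2 : 'I_n2 -> T -> R)
  (w1 : 'rV[R]_n1) (w2 : 'rV[R]_n2) (A B : set R) :
  measurable E -> (forall j, measurable_fun setT (X1 j)) ->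
  (forall j, measurable_fun setT (X2 j)) -> cond_indep P E X1 X2 ->
  measurable A -> measurable B ->
  (P (E `&` lincomb w1 X1 @^-1` A `&` lincomb w2 X2 @^-1` B) * P E =
   P (E `&` lincomb w1 X1 @^-1` A) * P (E `&` lincomb w2 X2 @^-1` B))%E.
Proof.
move=> mE mX1 mX2 indep mA mB.
have mlB : measurable (lincomb w2 X2 @^-1` B).
  by rewrite -[X in measurable X]setTI; exact: measurable_lincomb.
apply: (g_sigma_algebra_indep (G := cylinders X1)) => //.
- exact: cylinders_measurable.
- exact: cylinders_setI.
- exact: cylinders_setT.
- move=> C GC; have mC := cylinders_measurable mX1 GC.
  rewrite setIAC [RHS]muleC.
  apply: (g_sigma_algebra_indep (G := cylinders X2)) => //.
  + exact: cylinders_measurable.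
  + exact: cylinders_setI.
  + exact: cylinders_setT.
  + move=> _ [A2 mA2 <-]; case: GC => A1 mA1 <-.
    by rewrite setIAC [RHS]muleC; exact: indep.
  + exact: lincomb_cylinders.
- exact: lincomb_cylinders.
Qed.

(** Given [E], the two linear combinations are independent normal variables, so their joint law is a
    product measure and their sum has the convolved law. *)
Lemma cond_gaussian_sum E n1 n2 (X1 : 'I_n1 -> T -> R) (X2 : 'I_n2 -> T -> R)
  m1 S1 m2 S2 (w1 : 'rV[R]_n1) (w2 : 'rV[R]_n2) :
  measurable E -> (forall j, measurable_fun setT (X1 j)) ->
  (forall j, measurable_fun setT (X2 j)) -> cond_indep P E X1 X2 ->
  cond_gaussian P E X1 m1 S1 -> cond_gaussian P E X2 m2 S2 ->
  posdef S1 -> posdef S2 -> w2 != 0 ->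
  forall A : set R, measurable A ->
  P (E `&` (fun t => lincomb w1 X1 t + lincomb w2 X2 t) @^-1` A) =
  (P E * normal_prob (dotrv w1 m1 + dotrv w2 m2)
     (Num.sqrt (qform S1 w1 + qform S2 w2)) A)%E.
Proof.
move=> mE mX1 mX2 indep G1 G2 pS1 pS2 w20 A mA.
have q2 : 0 < qform S2 w2 by exact: pS2.2.
(* [cond_gaussian] covers nonzero weights; for [w1 = 0] the sum is the second combination. *)
have [->|w10] := eqVneq w1 0.
  have -> : qform S1 0 = 0 by rewrite /qform !mul0mx mxE.
  have -> : dotrv 0 m1 = 0 by rewrite /dotrv mul0mx mxE.
  rewrite !add0r -(G2 _ w20 _ mA); congr (P (_ `&` _)); apply/seteqP.
  have l0 t : lincomb 0 X1 t = 0 by rewrite /lincomb big1// => j _; rewrite mxE mul0r.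
  by split=> t; rewrite /preimage /= l0 add0r.
have q1 : 0 < qform S1 w1 by exact: pS1.2.
have mU := measurable_lincomb w1 mX1; have mV := measurable_lincomb w2 mX2.
have mUV : measurable_fun setT
    (fun t => (lincomb w1 X1 t : mR, lincomb w2 X2 t : mR)).
  exact: measurable_fun_pair.
have [PE0|PE0] := eqVneq (P E) 0.
  rewrite PE0 mul0e; apply/eqP; rewrite -measure_le0 -PE0 le_measure ?inE//.
  apply: measurableI => //; rewrite -[X in measurable X]setTI.
  by apply: measurable_funD.
have PEf : P E \is a fin_num by exact: fin_num_measure.
have c0 : 0 <= (fine (P E))^-1 by rewrite invr_ge0 fine_ge0.
have PEV : ((fine (P E))^-1%:E * P E = 1)%E.
  by rewrite -{2}(fineK PEf) -EFinM mulVf// fine_eq0.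
(* [m'] is the joint law of the two combinations conditioned on [E]; its values on rectangles
   identify it as the product of the two normal laws. *)
have [m' m'P] : exists m' : {measure set (mR * mR) -> \bar R}, forall X, m' X =
    ((fine (P E))^-1%:E *
     P (E `&` (fun t => (lincomb w1 X1 t, lincomb w2 X2 t)) @^-1` X))%E.
  unshelve eexists (mscale (NngNum c0) (pushforward (mrestr P mE)
    (fun t => (lincomb w1 X1 t : mR, lincomb w2 X2 t : mR)))).
    exact: mUV.
  by move=> X; rewrite /mscale /pushforward /mrestr /= setIC.
have sq (q : R) : 0 < q -> Num.sqrt q != 0 by move=> ?; rewrite gt_eqF// sqrtr_gt0.
have m'E (B C : set mR) : measurable B -> measurable C ->
    m' (B `*` C) = (normal_prob (dotrv w1 m1) (Num.sqrt (qform S1 w1)) B *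
                    normal_prob (dotrv w2 m2) (Num.sqrt (qform S2 w2)) C)%E.
  move=> mB mC.
  have := lincomb_cond_indep w1 w2 mE mX1 mX2 indep mB mC.
  rewrite (G1 _ w10 _ mB) (G2 _ w20 _ mC) m'P -setIA.
  have -> : (fun t => (lincomb w1 X1 t, lincomb w2 X2 t)) @^-1` (B `*` C) =
    lincomb w1 X1 @^-1` B `&` lincomb w2 X2 @^-1` C by [].
  have aux (e c p n1' n2' : \bar R) : (c * e = 1 -> p * e = e * n1' * (e * n2') ->
      c * p = n1' * n2')%E.
    move=> ce pe; rewrite -[p]mule1 -ce (muleC c e) (muleA p) pe (muleC _ c) muleACA.
    by rewrite !muleA -(muleA c c e) ce mule1 ce mul1e.
  exact: aux PEV.
have mS : measurable [set p : mR * mR | A (p.1 + p.2)%R].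
  rewrite -[X in measurable X]setTI.
  by apply: (@measurable_funD _ (mR * mR)%type R setT) => //; exact: mA.
have := normal_prob_conv (dotrv w1 m1) _ (dotrv w2 m2) _ _ (sq _ q1) (sq _ q2) mA.
rewrite (product_measure_unique m'E)// !sqr_sqrtr ?(ltW q1) ?(ltW q2)// => <-.
by rewrite m'P muleA (muleC (P E)) PEV mul1e.
Qed.

End independence.

(** * Calibration *)

Section lusin_calibration.
Import numFieldNormedType.Exports.
Set Implicit Arguments.
Unset Strict Implicit.
Context {R : realType}.
Notation mu := (@lebesgue_measure R).
Notation mR := (measurableTypeR R).

(* This replaces the Lusin-Souslin theorem: the sets [B `&` K] that are
   preimages of Borel sets form a sigma-algebra of traces, which contains the
   traces of closed sets because [h] maps compact subsets of [K] to compacts. *)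
Lemma injective_preimage_compact (h : R -> R) (K : set R) : injective h ->
  compact K -> {within K, continuous h} ->
  forall B : set mR, measurable B ->
    exists2 A : set mR, measurable A & h @^-1` A = B `&` K.
Proof.
move=> hI cK ch.
pose Phi := [set B : set mR |
  exists2 A : set mR, measurable A & h @^-1` A = B `&` K].
have Pclosed (B : set R) : closed B -> Phi B.
  (* The image is compact, hence Borel, and by injectivity it pulls back to exactly [B] within
     [K]. *)
  move=> cB; exists (h @` (B `&` K)).
    apply: compact_measurable; apply: continuous_compact.
      by apply: continuous_subspaceW ch; exact: subIsetr.
    by rewrite setIC; exact: compact_closedI.
  apply/seteqP; split=> x /=; first by move=> [y BKy /hI <-].
  by exists x.
suff sub : @measurable _ mR `<=` Phi by move=> B /sub.
have -> : @measurable _ mR = <<s @RGenCInfty.G R >> by exact: RGenCInfty.measurableE.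
apply: smallest_sub; last by move=> _ [x ->]; apply: Pclosed; exact: rray_closed.
split.
- exact/Pclosed/closed0.
(* The complement is taken inside a Borel set [AK] that pulls back to [K], so that the preimage
   stays in [K]. *)
- move=> B [A mA hA]; have [AK mAK hAK] : Phi setT by exact/Pclosed/closedT.
  exists (AK `\` A); first exact: measurableD.
  have hAE x : A (h x) = (B x /\ K x) by exact: (congr1 (fun S => S x) hA).
  have hAKE x : AK (h x) = (True /\ K x) by exact: (congr1 (fun S => S x) hAK).
  by apply/seteqP; split=> x /=; rewrite /setD /= hAE hAKE; tauto.
- move=> F PF; pose A n := sval (cid2 (PF n)).
  have AP n : measurable (A n : set mR) /\ h @^-1` A n = F n `&` K.
    by rewrite /A; case: cid2.
  exists (\bigcup_n A n); first by apply: bigcupT_measurable => n; exact: (AP n).1.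
  rewrite preimage_bigcup setI_bigcupl; apply: eq_bigcupr => n _; exact: (AP n).2.
Qed.

(** Lusin's theorem on [[0, 1]] with error 1/2: a null [K] would leave out measure 1. *)
Lemma lusin_compact (h : mR -> R) : measurable_fun setT h ->
  exists K : set R, [/\ compact K, {within K, continuous (h : R -> R)} & (0 < mu K)%E].
Proof.
move=> mh.
have m01 : mu `[0, 1]%classic = 1%E by rewrite lebesgue_measure_itv/= lte01 oppr0 adde0.
have mI : measurable (`[0, 1]%classic : set mR) by exact: measurable_itv.
have fI : (mu `[0%R, 1%R]%classic < +oo)%E by rewrite [ltLHS]m01 ltry.
have h0 : 0 < 2^-1 :> R by rewrite invr_gt0.
have [K [cK K01 Ke ch]] :=
  measurable_almost_continuous mI fI h0 (measurable_funTS mh).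
exists K; split => //; rewrite lt0e measure_ge0 andbT; apply/negP => /eqP K0.
have mK : measurable (K : set mR) by exact: compact_measurable.
move: Ke; rewrite measureD// setIidr// [X in (_ - X)%E]K0 sube0 [ltLHS]m01 lte_fin.
by rewrite ltNge invf_le1// ler1n.
Qed.

(** The two sides are densities with equal integrals over each Borel subset [B] of [K]: as [B] is
    the preimage under [h] of a Borel set, calibration applies to the event that [Z] lies in [B]. *)
Lemma calibrated_ae_eq {d : measure_display} {T : measurableType d}
  (P : probability T R) (Y : set T) (Z : T -> R) (h : R -> R) (K : set R)
  (eta m s : R) :
  measurable Y -> measurable_fun setT Z -> measurable_fun setT h ->
  (forall t, 0 < h t < 1) -> injective h -> compact K ->
  {within K, continuous h} -> s != 0 -> 0 <= eta <= 1 ->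
  (forall A : set R, measurable A ->
     P (Y `&` Z @^-1` A) = (eta%:E * normal_prob m s A)%E) ->
  (forall A : set R, measurable A ->
     P (~` Y `&` Z @^-1` A) = ((1 - eta)%:E * normal_prob (- m) s A)%E) ->
  calibrated P Y (h \o Z) ->
  {ae mu, forall t : mR, K t -> eta * normal_pdf m s t =
    h t * (eta * normal_pdf m s t + (1 - eta) * normal_pdf (- m) s t)}.
Proof.
move=> mY mZ mh h01 hI cK ch s0 /andP[eta0 eta1] lawY lawNY cal.
have eta'0 : 0 <= 1 - eta by rewrite subr_ge0.
have mK : measurable (K : set mR) by exact: compact_measurable.
have mpdf a (B : set mR) : measurable_fun B (fun x : mR => (normal_pdf a s x)%:E).
  by apply: measurable_funTS; apply/measurable_EFinP; exact: measurable_normal_pdf.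
have mhE (B : set mR) : measurable_fun B (fun x : mR => (h x)%:E).
  by apply: measurable_funTS; apply/measurable_EFinP.
have h0 x : (0 <= (h x)%:E)%E by rewrite lee_fin ltW//; case/andP: (h01 x).
have pdf0 a x : (0 <= (normal_pdf a s x)%:E)%E by rewrite lee_fin normal_pdf_ge0.
pose f (t : mR) : \bar R := (eta%:E * (normal_pdf m s t)%:E)%E.
pose g (t : mR) : \bar R := (eta%:E * ((h t)%:E * (normal_pdf m s t)%:E) +
  (1 - eta)%:E * ((h t)%:E * (normal_pdf (- m) s t)%:E))%E.
suff : ae_eq mu K f g.
  apply: filterS => t /[apply]; rewrite /f /g -!EFinM -EFinD => -[E]; rewrite [LHS]E.
  by ring.
apply: integral_ae_eq => //.
- apply: (integrableS measurableT) => //; apply: integrableZl => //.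
  exact: integrable_normal_pdf.
- apply: emeasurable_funD; apply: emeasurable_funM => //; exact: emeasurable_funM.
move=> B BK mB.
have [A mA hA] := injective_preimage_compact hI cK ch mB.
have {}hA : h @^-1` A = B by rewrite hA setIidl.
transitivity (P (Y `&` Z @^-1` B)).
  rewrite lawY// /normal_prob ge0_integralZl//.
rewrite -hA -comp_preimage cal// comp_preimage hA.
(* [m1] and [m2] are the contributions of the two classes; their sum is the unconditional law of
   [Z]. *)
pose m1 := mscale (NngNum eta0) (normal_prob m s).
pose m2 := mscale (NngNum eta'0) (normal_prob (- m) s).
transitivity (\int[pushforward P (Z : T -> mR)]_(x in B) (h x)%:E)%E.
  by rewrite ge0_integral_pushforward.
transitivity (\int[measure_add m1 m2]_(x in B) (h x)%:E)%E.
  apply: eq_measure_integral => C mC _; rewrite [RHS]measure_addE.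
  have mZC : measurable (Z @^-1` C) by rewrite -[X in measurable X]setTI; exact: mZ.
  transitivity (P (Y `&` Z @^-1` C) + P (~` Y `&` Z @^-1` C))%E; last first.
    by rewrite lawY// lawNY.
  rewrite -measureU//; last by rewrite setIACA setICr set0I.
  - by rewrite -setIUl setUCr setTI.
  - exact: measurableI.
  - by apply: measurableI => //; exact: measurableC.
rewrite ge0_integral_measure_add//= !ge0_integral_mscale//=.
rewrite !ge0_integral_normal_prob// /g ge0_integralD//; last 4 first.
- by move=> x _; rewrite !mule_ge0// lee_fin.
- by apply: emeasurable_funM => //; exact: emeasurable_funM.
- by move=> x _; rewrite !mule_ge0// lee_fin.
- by apply: emeasurable_funM => //; exact: emeasurable_funM.
rewrite !ge0_integralZl//.
- by apply: emeasurable_funM.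
- by move=> x _; rewrite mule_ge0// lee_fin.
- by apply: emeasurable_funM.
- by move=> x _; rewrite mule_ge0// lee_fin.
Qed.

(** Points are null and [K] is not. This extracts from an a.e. identity a nonzero point, or a second
    point distinct from a given one. *)
Lemma ae_exists_neq (K : set mR) (Q : mR -> Prop) (a b : R) : measurable K ->
  (0 < mu K)%E -> {ae mu, forall t, K t -> Q t} ->
  exists t : R, [/\ Q t, t != a & t != b].
Proof.
move=> mK K0 aeQ; apply: contrapT => noQ.
have aeN (c : R) : {ae mu, forall t : mR, t <> c}.
  exists [set c]; split => //; first exact: lebesgue_measure_set1.
  by move=> t /= /contrapT.
have : {ae mu, forall t, ~ K t}.
  move: aeQ (aeN a) (aeN b); apply: filterS3.
  by move=> t KQ /eqP ta /eqP tb /KQ Qt; apply: noQ; exists t.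
move=> aeK; have /negligibleP : mu.-negligible K.
  by apply: negligibleS aeK => t Kt; apply.
by move=> /(_ mK) KE; move: K0; rewrite KE ltxx.
Qed.

End lusin_calibration.

(** * Likelihood ratio and posterior odds *)

Section posterior.
Set Implicit Arguments.
Unset Strict Implicit.
Context {R : realType}.
Implicit Types (m s t eta p e : R).

(** The variances being equal, the quadratic terms cancel and the log-likelihood ratio is linear in
    [t]. *)
Lemma normal_pdf_ratio m s t : s != 0 ->
  normal_pdf m s t = expR (2 * t * (m / s ^+ 2)) * normal_pdf (- m) s t.
Proof.
move=> s0; rewrite !normal_pdfE// /normal_fun mulrCA -expRD.
by congr (_ * expR _); field; rewrite s0.
Qed.

(** Bayes' formula with posterior [p] and likelihood ratio [e], solved for [e]. A prior of 0 or 1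
    would force [p] to be 0 or 1. *)
Lemma posterior_odds eta p e : 0 <= eta <= 1 -> 0 < p < 1 -> 0 < e ->
  eta * e = p * (eta * e + (1 - eta)) ->
  [/\ 0 < eta < 1 & e = p * (1 - eta) / (eta * (1 - p))].
Proof.
move=> /andP[eta0 eta1] /andP[p0 p1] e0 E.
have eta_neq0 : eta != 0 by apply/eqP => z; move: E; rewrite z; nra.
have eta_neq1 : eta != 1 by apply/eqP => z; move: E; rewrite z; nra.
split; first by rewrite !lt_neqAle eta0 eta1 eq_sym eta_neq0 eta_neq1.
apply: (@mulfI _ (eta * (1 - p))).
  by rewrite mulf_neq0// subr_eq0 gt_eqF.
rewrite [RHS]mulrC divfK; last by rewrite mulf_neq0// subr_eq0 gt_eqF.
by move: E; lra.
Qed.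

End posterior.

(** * Linear algebra of general position *)

Section general_position.
Set Implicit Arguments.
Unset Strict Implicit.
Context {R : realType}.

(** The hypothesis puts the column [(w, -a)] in the kernel of the matrix of general position, which
    has full column rank and hence a left inverse. *)
Lemma general_position_affine_eq0 k dsp (Sig : 'I_k -> 'M[R]_dsp)
  (mu : 'I_k -> 'rV[R]_dsp) (w x : 'rV[R]_dsp) (a : R) :
  general_position Sig mu -> x != 0 ->
  (forall i, dotrv (x *m (Sig i)^T + mu i) w = a) -> w = 0.
Proof.
move=> gp x0 xa; have /eqP := gp x x0.
set M := (\matrix_(i < k) _) => /row_fullP[B BM].
have M0 : M *m col_mx w^T (- a)%:M = 0.
  apply/row_matrixP => i; rewrite row_mul rowK row0 mul_row_col mul1mx.
  apply/matrixP => u v; rewrite !ord1 mxE [X in _ + X]mxE [RHS]mxE eqxx mulr1n.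
  by have := xa i; rewrite /dotrv => ->; rewrite subrr.
have : col_mx w^T (- a)%:M = 0 by rewrite -[LHS]mul1mx -BM -mulmxA M0 mulmx0.
rewrite -[RHS]vsubmxK => /eq_col_mx[/(congr1 trmx)]; rewrite trmxK => -> _.
by rewrite linear0 trmx0.
Qed.

End general_position.

(** * Comparison of the environments *)

Theorem theorem1 (R : realType) (d : measure_display) (T : measurableType d)
  (dns dsp k : nat) (Hk : (2 * dsp < k)%N)
  (eta : R) (mu_ns : 'rV[R]_dns) (S_ns : 'M[R]_dns)
  (mu : 'I_k -> 'rV[R]_dsp) (Sig : 'I_k -> 'M[R]_dsp)
  (P : 'I_k -> probability T R) (Y : 'I_k -> set T)
  (Xns : 'I_k -> 'I_dns -> T -> R) (Xsp : 'I_k -> 'I_dsp -> T -> R)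
  (HSns : posdef S_ns) (HSig : forall i, posdef (Sig i))
  (Henv : forall i, env_model (P i) (Y i) (Xns i) (Xsp i) eta mu_ns S_ns (mu i) (Sig i))
  (sigma : R -> R) (Hsig01 : forall t, 0 < sigma t < 1)
  (Hsiginj : injective sigma)
  (Hsigsurj : forall a, 0 < a < 1 -> exists t, sigma t = a)
  (Hsigm : measurable_fun setT sigma)
  (Hgp : general_position Sig mu) :
  forall (wns : 'rV[R]_dns) (wsp : 'rV[R]_dsp) (b : R),
    (forall i, calibrated (P i) (Y i) (score sigma wns wsp b (Xns i) (Xsp i))) ->
    wsp = 0.
Proof.
move=> wns wsp b cal; apply/eqP/negP => /negP w0.
pose h (t : R) := sigma (t - b).
have mh : measurable_fun setT h.
  by apply: measurableT_comp => //; exact: measurable_funB.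
have hI : injective h by move=> x y /Hsiginj /addIr.
have [K [cK ch K0]] := lusin_compact mh.
have mK : measurable (K : set (measurableTypeR R)) by exact: compact_measurable.
pose m i := dotrv wns mu_ns + dotrv wsp (mu i).
pose q i := qform S_ns wns + qform (Sig i) wsp.
have q0 i : 0 < q i.
  rewrite /q ltr_wpDl//; last by case: (HSig i) => _; exact.
  have [->|wns0] := eqVneq wns 0; first by rewrite /qform !mul0mx mxE.
  by apply/ltW; case: HSns => _; exact.
(* A reference environment, against which all others are compared. *)
have i0 : 'I_k by exact: Ordinal (leq_ltn_trans (leq0n _) Hk).
have eta01 : 0 <= eta <= 1.
  have [_ [_ [_ [PY _]]]] := Henv i0.
  by rewrite -!lee_fin -PY measure_ge0/= probability_le1//; case: (Henv i0).
have post i : {ae (@lebesgue_measure R), forall t : measurableTypeR R, K t ->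
    0 < eta < 1 /\
    expR (2 * t * (m i / q i)) = h t * (1 - eta) / (eta * (1 - h t))}.
  have [mY [mXns [mXsp [PY [Gns [Gns' [Gsp [Gsp' [ind ind']]]]]]]]] := Henv i.
  have PnY : P i (~` Y i) = (1 - eta)%:E by rewrite probability_setC// PY.
  have s0 : Num.sqrt (q i) != 0 by rewrite gt_eqF// sqrtr_gt0.
  pose Z t := lincomb wns (Xns i) t + lincomb wsp (Xsp i) t.
  have mZ : measurable_fun setT Z by apply: measurable_funD; exact: measurable_lincomb.
  have lawY (A : set R) : measurable A ->
      P i (Y i `&` Z @^-1` A) = (eta%:E * normal_prob (m i) (Num.sqrt (q i)) A)%E.
    by rewrite -PY; exact: cond_gaussian_sum.
  have dotrvN n (u v : 'rV[R]_n) : dotrv u (- v) = - dotrv u v.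
    by rewrite /dotrv linearN mulmxN mxE.
  have lawNY (A : set R) : measurable A ->
      P i (~` Y i `&` Z @^-1` A) =
      ((1 - eta)%:E * normal_prob (- m i) (Num.sqrt (q i)) A)%E.
    rewrite -PnY /m opprD -!dotrvN; apply: cond_gaussian_sum => //.
    exact: measurableC.
  have h01 t : 0 < h t < 1 by exact: Hsig01.
  have := calibrated_ae_eq mY mZ mh h01 hI cK ch s0 eta01 lawY lawNY (cal i).
  apply: filterS => t /[apply].
  rewrite (normal_pdf_ratio _ _ s0) sqr_sqrtr ?(ltW (q0 i))// => E.
  apply: posterior_odds => //; first exact: expR_gt0.
  (* Dividing by the density of the class [y = -1] leaves the equation of [posterior_odds] for the
     likelihood ratio. *)
  have p0 : normal_pdf (- m i) (Num.sqrt (q i)) t != 0.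
    by rewrite normal_pdfE// mulf_neq0// gt_eqF// ?normal_peak_gt0 ?expR_gt0.
  by apply: (mulIf p0); move: E; set e := expR _; lra.
(* The right-hand side of [post] is the same in every environment; at a common [t != 0] the
   exponents can be compared and [2 * t] cancelled. *)
have slope i : m i / q i = m i0 / q i0.
  have [|t [[[_ Ei] [_ E0]] t0 _]] := ae_exists_neq 0 0 mK K0 _ (Q := fun t : R =>
    (0 < eta < 1 /\ expR (2 * t * (m i / q i)) = h t * (1 - eta) / (eta * (1 - h t))) /\
    (0 < eta < 1 /\ expR (2 * t * (m i0 / q i0)) = h t * (1 - eta) / (eta * (1 - h t)))).
    by move: (post i) (post i0); apply: filterS2 => t A B Kt; split; [exact: A|exact: B].
  move: E0; rewrite -Ei => /expR_inj /mulfI -> //.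
  by rewrite mulf_neq0// pnatr_eq0.
set c := m i0 / q i0 in slope.
(* With [c = 0] the likelihood ratio is 1, so [h] would take the value [eta] at two distinct
   points. *)
have c0 : c != 0.
  apply/eqP => c0; have := post i0; rewrite -/c c0 => postc.
  have eqh (t : R) : 0 < eta < 1 /\
      expR (2 * t * 0) = h t * (1 - eta) / (eta * (1 - h t)) -> h t = eta.
    move=> [/andP[e0 e1]]; rewrite mulr0 expR0 => /esym/divr1_eq E.
    by move: E; lra.
  have [t1 [/eqh ht1 _ _]] := ae_exists_neq 0 0 mK K0 postc.
  have [t2 [/eqh ht2 t21 _]] := ae_exists_neq t1 t1 mK K0 postc.
  by move/eqP: t21; apply; apply: hI; rewrite ht1.
have x0 : - c *: wsp != 0 by rewrite scaler_eq0 oppr_eq0 negb_or c0.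
move/eqP: w0; apply.
(* The constant [a] collects the terms of [m i = c * q i] that come from the [ns] block, which all
   environments share. *)
apply: (general_position_affine_eq0 (a := c * qform S_ns wns - dotrv wns mu_ns) Hgp x0).
move=> i; have [SigT _] := HSig i.
have qi0 : q i != 0 by rewrite gt_eqF.
have -> : dotrv (- c *: wsp *m (Sig i)^T + mu i) wsp =
    - c * qform (Sig i) wsp + dotrv wsp (mu i).
  rewrite /dotrv SigT mulmxDl mxE -!scalemxAl [X in X + _]mxE; congr (_ + _).
  have -> : mu i *m wsp^T = (wsp *m (mu i)^T)^T by rewrite trmx_mul trmxK.
  by rewrite mxE.
have : m i = c * q i by rewrite -(slope i) divfK.
by rewrite /m /q; lra.
Qed.
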